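(* Let $h_1\ge h_2>0$ and $h_3\ge 0$ be integers and let $n=h_1+h_2+h_3$. Then there exists an $\mathrm{ILS}(n;h_1h_2)$ if and only if $h_3\ge h_1$.
   Context: A latin square of order $n$ is an $n\times n$ array filled with symbols from $\{1,\dots,n\}$ such that each symbol occurs exactly once in every row and every column. A subsquare of order $m$ is an $m\times m$ subarray (given by a set of $m$ rows and a set of $m$ columns, not necessarily consecutive) which is itself a latin square of order $m$ on some set of $m$ symbols. Subsquares are disjoint if they share no rows, no columns and no symbols. For positive integers $h_1,\dots,h_k$ with $h_1+\dots+h_k\le n$, an incomplete latin square $\mathrm{ILS}(n;h_1\dots h_k)$ is a (completely filled) latin square of order $n$ with $k$ pairwise disjoint subsquares of orders $h_1,\dots,h_k$. In particular an $\mathrm{ILS}(n;h_1h_2)$ is a latin square of order $n$ with two disjoint subsquares, of orders $h_1$ and $h_2$. *)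

(* Defs.v *)
From mathcomp Require Import all_boot all_order all_algebra.

Set Implicit Arguments.
Unset Strict Implicit.
Unset Printing Implicit Defensive.

(* The symbols 1, ..., n are represented by the elements 0, ..., n-1 of 'I_n. *)
Definition array (n : nat) := 'M['I_n]_n.

(* The subarray of L on rows R and columns C is a latin square of order m on
   the symbol set S. *)
Definition latin_on (n : nat) (L : array n) (m : nat)
    (R C S : {set 'I_n}) : Prop :=
  [/\ [/\ #|R| = m, #|C| = m & #|S| = m],
      forall r c, r \in R -> c \in C -> L r c \in S,
      forall r s, r \in R -> s \in S -> #|[set c in C | L r c == s]| = 1
    & forall c s, c \in C -> s \in S -> #|[set r in R | L r c == s]| = 1].

Definition latin_square (n : nat) (L : array n) : Prop :=
  latin_on L n setT setT setT.

Definition is_ILS (n : nat) (hs : seq nat) (L : array n) : Prop :=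
  latin_square L /\
  exists R C S : 'I_(size hs) -> {set 'I_n},
    (forall i : 'I_(size hs), latin_on L (nth 0 hs i) (R i) (C i) (S i)) /\
    (forall i j : 'I_(size hs), i != j ->
       [/\ [disjoint R i & R j], [disjoint C i & C j]
         & [disjoint S i & S j]]).

(* Main.v *)
(** An incomplete square forces [h1 <= h3]: in a column of the second subsquare,
    the [h1] rows of the first one carry distinct symbols from neither subsquare.

    Conversely, count the cells of a putative square by the classes (first
    subsquare, second subsquare, rest) of their row, column and symbol.  When
    [h2 <= h1 <= h3] there are natural numbers [T a b c] with the line sums such
    counts must have, vanishing where the subsquares require it.  Any such
    "outline square" comes from a latin square (Hilton): split the row classes
    into single rows, then the column classes, then the symbol classes.  Each
    splitting amounts to cutting a natural number matrix with row sums [h * r]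
    and column sums [h * c] into [h] matrices with sums [r] and [c], which is
    done one summand at a time by an augmenting path argument. *)
Require Import Defs.
From mathcomp Require Import all_boot all_order all_algebra.
From mathcomp Require Import zify.

Set Implicit Arguments.
Unset Strict Implicit.
Unset Printing Implicit Defensive.

(** * Cutting matrices of natural numbers by augmenting paths *)

Lemma sum_eq_indicator (Y : finType) (y0 : Y) : \sum_y (y == y0) = 1.
Proof.
by rewrite (bigD1 y0) //= eqxx big1 // => y /negPf ->.
Qed.

Lemma bounded_with_sum (Y : finType) (f : Y -> nat) (r : nat) :
  r <= \sum_y f y -> exists2 g : Y -> nat, forall y, g y <= f y & \sum_y g y = r.
Proof.
elim: r => [|r IHr] le_r; first by exists (fun=> 0); rewrite ?big1.
have [g le_gf sum_g] := IHr (ltnW le_r).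
have [/existsP[y0 lt_gf]|/existsPn ge_gf] := boolP [exists y, g y < f y]; last first.
  have: \sum_y f y <= r by rewrite -sum_g leq_sum // => y _; rewrite leqNgt.
  by rewrite leqNgt le_r.
exists (fun y => g y + (y == y0)) => [y|].
  by case: eqP => [->|_]; rewrite ?addn1 ?addn0.
by rewrite big_split /= sum_eq_indicator sum_g addn1.
Qed.

Section Augmentation.

Variables (X Y : finType) (M : X -> Y -> nat).
Implicit Type N : X -> Y -> nat.

(** Residual graph on the columns: along an edge, some row can move one unit of [N] and stay below
    [M]. *)
Definition shiftable N : rel Y :=
  fun y y' => [exists x, (0 < N x y) && (N x y' < M x y')].

(* On a simple path, a shift along the first edge leaves the later ones
   shiftable. *)
Lemma augment_path (r : X -> nat) N y0 p :
    (forall x y, N x y <= M x y) -> (forall x, \sum_y N x y = r x) ->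
    path (shiftable N) y0 p -> uniq (y0 :: p) ->
  exists N', [/\ forall x y, N' x y <= M x y, forall x, \sum_y N' x y = r x
    & forall y, \sum_x N' x y + (y == y0) = \sum_x N x y + (y == last y0 p)].
Proof.
elim: p N y0 => [|y1 p IHp] N y0 leNM rowN /=; first by exists N.
case/andP=> /existsP[x1 /andP[N0_gt0 N1_lt]] pathp.
rewrite inE negb_or => /andP[/andP[neq01 y0p] /= /andP[y1p uniq_p]].
pose N1 x y := N x y + (x == x1) * (y == y1) - (x == x1) * (y == y0).
have N1E x y : N1 x y + (x == x1) * (y == y0) = N x y + (x == x1) * (y == y1).
  rewrite /N1 subnK //; have [->|_] := eqVneq x x1; last by [].
  have [->|_] := eqVneq y y0; last by [].
  by rewrite mul1n (leq_trans N0_gt0) ?leq_addr.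
have leN1M x y : N1 x y <= M x y.
  have := N1E x y; have := leNM x y; have [->|_] := eqVneq x x1; last by lia.
  by have [->|_] := eqVneq y y1; lia.
have rowN1 x : \sum_y N1 x y = r x.
  apply/eqP; rewrite -(eqn_add2r ((x == x1) * \sum_y (y == y0))) big_distrr /=.
  rewrite -big_split /= (eq_bigr _ (fun y _ => N1E x y)) big_split /= rowN.
  by rewrite -!big_distrr /= !sum_eq_indicator.
have colN1 y : \sum_x N1 x y + (y == y0) = \sum_x N x y + (y == y1).
  rewrite -[(y == y0) : nat]mul1n -[(y == y1) : nat]mul1n -(sum_eq_indicator x1).
  by rewrite !big_distrl /= -!big_split; apply: eq_bigr => x _; exact: N1E.
(* The shift changes only columns [y0] and [y1]. The rest of the path avoids [y0] and meets [y1]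
   only as its start, where a gain does no harm. *)
have path_shift z : path (shiftable N) z p -> all (fun y => y != y1) p ->
    all (fun y => y != y0) (z :: p) -> path (shiftable N1) z p.
  elim: p z {IHp pathp y0p y1p uniq_p} => //= z p IHp y.
  case/andP=> /existsP[x /andP[Ny Nz]] pathz /andP[zy1 py1] /and3P[yy0 zy0 py0].
  rewrite IHp ?zy0 ?py0 // andbT; apply/existsP; exists x.
  have := N1E x y; have := N1E x z.
  by rewrite (negPf zy1) (negPf zy0) (negPf yy0); lia.
have path1 : path (shiftable N1) y1 p.
  apply: path_shift => //=; last rewrite eq_sym neq01.
    by apply/allP => y yp; apply: contraNneq y1p => <-.
  by apply/allP => y yp; apply: contraNneq y0p => <-.
have [N' [leN'M rowN' colN']] := IHp N1 y1 leN1M rowN1 path1 ltac:(by rewrite /= y1p).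
by exists N'; split=> // y; have := colN' y; have := colN1 y; lia.
Qed.

(** [M] divided by [h.+1] is a fractional solution; an integral one is reached by rerouting units
    from overfull to underfull columns. *)
Lemma submatrix_with_sums (h : nat) (r : X -> nat) (c : Y -> nat) :
    (forall x, \sum_y M x y = h.+1 * r x) ->
    (forall y, \sum_x M x y = h.+1 * c y) ->
  exists N, [/\ forall x y, N x y <= M x y, forall x, \sum_y N x y = r x
              & forall y, \sum_x N x y = c y].
Proof.
move=> rowM colM.
have eq_total : \sum_x r x = \sum_y c y.
  apply/eqP; rewrite -(eqn_pmul2l (ltn0Sn h)) !big_distrr /=.
  rewrite -(eq_bigr _ (fun x _ => rowM x)) -(eq_bigr _ (fun x _ => colM x)).
  by rewrite exchange_big.
(* Row sums stay correct throughout. The induction is on the total column excess, truncated so that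
   deficits count as zero. *)
suff descent k N : (forall x y, N x y <= M x y) -> (forall x, \sum_y N x y = r x) ->
    \sum_y (\sum_x N x y - c y) <= k ->
    exists N, [/\ forall x y, N x y <= M x y, forall x, \sum_y N x y = r x
              & forall y, \sum_x N x y = c y].
  have /fin_all_exists[N N_P] x :
      exists g : Y -> nat, (forall y, g y <= M x y) /\ \sum_y g y = r x.
    have [|g leg sumg] := @bounded_with_sum Y (M x) (r x); last by exists g.
    by rewrite rowM mulSn leq_addr.
  by apply: (descent _ N _ _ (leqnn _)) => x; have [] := N_P x.
elim: k N => [|k IHk] N leNM rowN excess.
  have le_col y : \sum_x N x y <= c y.
    move: excess; rewrite leqn0 sum_nat_eq0 => /forall_inP/(_ y isT).
    by rewrite subn_eq0.
  (* Column sums bounded by [c] and with the same total as [c] must equal it. *)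
  exists N; split=> // y; apply/eqP.
  have := leqif_sum (fun y (_ : true) => leqif_eq (le_col y)).
  rewrite exchange_big /= (eq_bigr _ (fun x _ => rowN x)) eq_total => -[_].
  by rewrite eqxx => /esym/forall_inP/(_ y isT).
have [/existsP[y0 y0_over]|/existsPn le_col] := boolP [exists y, c y < \sum_x N x y]; last first.
  apply: (IHk N) => //; rewrite big1 // => y _.
  by apply/eqP; rewrite subn_eq0 leqNgt.
have [/existsP[y1 /andP[/connectP[p path_p ->]]]|/existsPn full] :=
  boolP [exists y, connect (shiftable N) y0 y && (\sum_x N x y < c y)].
  case/shortenP: path_p => q path_q uniq_q _ y1_under.
  have [N' [leN'M rowN' colN']] := augment_path leNM rowN path_q uniq_q.
  (* The excess drops by one at [y0]; the end of the path was underfull, so its unit creates no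
     excess. *)
  apply: (IHk N') => //; rewrite -ltnS; apply: leq_trans excess.
  rewrite (bigD1 y0) //= [ltnRHS](bigD1 y0) //=.
  have neq_last : y0 != last y0 q.
    by apply: contraTneq y1_under => <-; rewrite -leqNgt ltnW.
  rewrite -addSn leq_add //.
    by have := colN' y0; rewrite eqxx (negPf neq_last); lia.
  apply: leq_sum => y neq_y; have := colN' y; rewrite (negPf neq_y).
  by move: y1_under => /=; case: eqP => [->|_]; lia.
(* The columns reachable from [y0] hold too much of [N], yet in every row at
   most the fraction 1/(h+1) of what [M] has there. *)
pose U := connect (shiftable N) y0.
have row_bound x : h.+1 * \sum_(y | U y) N x y <= \sum_(y | U y) M x y.
  have [/existsP[y /andP[Uy Ny_gt0]]|/existsPn N0] := boolP [exists y, U y && (0 < N x y)].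
    (* An unsaturated column here would be reachable through [y]. So [N] takes all of [M] outside
       [U] in this row, which leaves at most its fair share inside. *)
    have tight z : ~~ U z -> N x z = M x z.
      move=> nUz; apply/eqP; rewrite eqn_leq leNM leqNgt.
      apply: contra nUz => lt_z; apply: connect_trans Uy (connect1 _).
      by apply/existsP; exists x; rewrite Ny_gt0.
    have := rowM x; have := rowN x; rewrite (bigID U) /= [in X in _ -> X](bigID U) /=.
    by rewrite (eq_bigr _ tight); nia.
  rewrite big1 ?muln0 // => y Uy; apply/eqP.
  by have := N0 y; rewrite Uy /= -eqn0Ngt.
have : \sum_(y | U y) c y < \sum_(y | U y) \sum_x N x y.
  rewrite (bigD1 y0) ?[ltnRHS](bigD1 y0) /U ?connect0 //= -addSn leq_add //.
  by apply: leq_sum => y /andP[Uy _]; have := full y; rewrite Uy /= -leqNgt.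
rewrite -(ltn_pmul2l (ltn0Sn h)) ltnNge => /negP[].
rewrite exchange_big !big_distrr /= -(eq_bigr _ (fun y _ => colM y)).
by rewrite exchange_big /=; apply: leq_sum => x _.
Qed.

End Augmentation.

Lemma split_matrix (I X Y : finType) (D : {set I}) (M : X -> Y -> nat)
    (r : X -> nat) (c : Y -> nat) :
    (forall x, \sum_y M x y = #|D| * r x) ->
    (forall y, \sum_x M x y = #|D| * c y) ->
  exists N : I -> X -> Y -> nat,
    [/\ forall i x, i \in D -> \sum_y N i x y = r x,
        forall i y, i \in D -> \sum_x N i x y = c y
      & forall x y, \sum_(i in D) N i x y = M x y].
Proof.
have [k] := ubnP #|D|; elim: k D M => // k IHk D M leDk rowM colM.
have [D0|[i0 i0D]] := set_0Vmem D.
  exists (fun _ _ _ => 0); rewrite D0; split=> [i x|i y|x y]; rewrite ?inE //.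
  rewrite big_set0; apply/esym/eqP; move: (rowM x); rewrite D0 cards0 => /eqP.
  by rewrite sum_nat_eq0 => /forall_inP->.
have cardD := cardsD1 i0 D; rewrite i0D add1n in cardD.
rewrite cardD in rowM colM leDk.
have [N0 [leN0M rowN0 colN0]] := submatrix_with_sums rowM colM.
have [||N [rowN colN sumN]] := IHk (D :\ i0) (fun x y => M x y - N0 x y) leDk.
- by move=> x; rewrite sumnB // rowM rowN0 mulSn addKn.
- by move=> y; rewrite sumnB // colM colN0 mulSn addKn.
exists (fun i => if i == i0 then N0 else N i); split=> [i x iD|i y iD|x y].
- by case: eqP => // /eqP neq_i; rewrite rowN // !inE neq_i.
- by case: eqP => // /eqP neq_i; rewrite colN // !inE neq_i.
rewrite (big_setD1 i0) //= eqxx -[RHS](subnKC (leN0M x y)) -sumN.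
by congr (_ + _); apply: eq_bigr => i; rewrite !inE => /andP[/negPf->].
Qed.

(** * From outline squares to latin squares *)

Section Outline.

Variables (I A : finType) (f : I -> A).
Let size_class a := #|[set i | f i == a]|.

(** Each slice [T a] is cut into one matrix per member of class [a]. The lemma serves in turn for
    rows, columns and symbols. *)
Lemma split_classes (Y Z : finType) (T : A -> Y -> Z -> nat)
    (q : Y -> nat) (s : Z -> nat) :
    (forall a y, \sum_z T a y z = size_class a * q y) ->
    (forall a z, \sum_y T a y z = size_class a * s z) ->
  exists T' : I -> Y -> Z -> nat,
    [/\ forall i y, \sum_z T' i y z = q y, forall i z, \sum_y T' i y z = s z
      & forall a y z, \sum_(i | f i == a) T' i y z = T a y z].
Proof.
move=> sumZ sumY.
have /fin_all_exists[N N_P] a := split_matrix (sumZ a) (sumY a).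
exists (fun i => N (f i) i); split=> [i y|i z|a y z].
- by have [rowN _ _] := N_P (f i); rewrite rowN ?inE.
- by have [_ colN _] := N_P (f i); rewrite colN ?inE.
have [_ _ <-] := N_P a.
by apply: eq_big => [i|i /eqP->//]; rewrite inE.
Qed.

(** After three splittings all line sums are 1, so the positive entries of [T3] are the cells of a
    latin square. Only positivity in [T] is recorded, since the zeros of [T] are what confines the
    subsquares. *)
Lemma latin_of_outline (T : A -> A -> A -> nat) :
    (forall a b, \sum_c T a b c = size_class a * size_class b) ->
    (forall a c, \sum_b T a b c = size_class a * size_class c) ->
    (forall b c, \sum_a T a b c = size_class b * size_class c) ->
  exists L : I -> I -> I,
    [/\ forall i, injective (L i), forall j, injective (L^~ j)
      & forall i j, 0 < T (f i) (f j) (f (L i j))].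
Proof.
move=> sum3 sum2 sum1.
have sum_fibers (F : I -> nat) : \sum_i F i = \sum_a \sum_(i | f i == a) F i.
  exact: (partition_big f xpredT).
have [T1 [T1_3 T1_2 T1_1]] := split_classes sum3 sum2.
(* The rows are now single, so a single column meets each of them in one cell and has [size_class c]
   cells with symbols of class [c]. *)
have [||T2 [T2_3 T2_1 T2_2]] :=
    @split_classes _ _ (fun b i c => T1 i b c) (fun=> 1) size_class.
- by move=> b i; rewrite T1_3 muln1.
- move=> b c; rewrite sum_fibers -sum1.
  by apply: eq_bigr => a _; rewrite T1_1.
have [||T3 [T3_2 T3_1 T3_3]] :=
    @split_classes _ _ (fun c i j => T2 j i c) (fun=> 1) (fun=> 1).
- move=> c i; rewrite sum_fibers muln1 -(T1_2 i).
  by apply: eq_bigr => b _; rewrite T2_2.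
- by move=> c j; rewrite T2_1 muln1.
have symbol i j : exists k, 0 < T3 k i j.
  have: \sum_k T3 k i j = 1.
    by rewrite sum_fibers -(T2_3 j i); apply: eq_bigr => c _; rewrite T3_3.
  have [/existsP//|/existsPn T3_0] := boolP [exists k, 0 < T3 k i j].
  by rewrite big1 // => k _; apply/eqP; rewrite eqn0Ngt.
have line1 (F : I -> nat) x y : \sum_z F z = 1 -> 0 < F x -> 0 < F y -> x = y.
  move=> sumF Fx Fy; apply/eqP; apply: contra_eqT sumF => neq_xy.
  by rewrite (bigD1 x) // (bigD1 y) 1?eq_sym //=; lia.
pose L i j := xchoose (symbol i j).
have LP i j : 0 < T3 (L i j) i j := xchooseP (symbol i j).
have le_fiber (F : I -> nat) i : F i <= \sum_(j | f j == f i) F j.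
  by rewrite (bigD1 i) ?leq_addr.
exists L; split=> [i j j' eqL|j i i' eqL|i j].
- by apply: line1 (T3_2 (L i j) i) (LP i j) _; rewrite eqL.
- by apply: line1 (T3_1 (L i j) j) (LP i j) _; rewrite eqL.
(* Undo the splittings: each entry is at most the sum over its class. *)
apply: leq_trans (LP i j) _.
rewrite -T1_1; apply: leq_trans (le_fiber (fun i => T1 i _ _) i).
rewrite -T2_2; apply: leq_trans (le_fiber (fun j => T2 j _ _) j).
by rewrite -T3_3; apply: le_fiber (fun k => T3 k _ _) _.
Qed.

End Outline.

(** * Subsquares and the necessary condition *)

(** An injection between sets of equal finite size is onto, so closure under [S] suffices. *)
Lemma latin_on_inj (n : nat) (L : array n) (m : nat) (R C S : {set 'I_n}) :
    (forall r, injective (L r)) -> (forall c, injective (L^~ c)) ->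
    #|R| = m -> #|C| = m -> #|S| = m ->
    (forall r c, r \in R -> c \in C -> L r c \in S) ->
  latin_on L m R C S.
Proof.
move=> injr injc cardR cardC cardS closed.
have hit (g : 'I_n -> 'I_n) (B : {set 'I_n}) s : injective g -> #|B| = m ->
    {in B, forall x, g x \in S} -> s \in S -> #|[set x in B | g x == s]| = 1.
  move=> injg cardB gS sS.
  have /eqP eqS : g @: B == S.
    rewrite eqEcard card_imset // cardB cardS leqnn andbT.
    by apply/subsetP => _ /imsetP[x xB ->]; apply: gS.
  move: sS; rewrite -eqS => /imsetP[x xB ->].
  rewrite -(cards1 x); apply: eq_card => y; rewrite !inE (inj_eq injg).
  by case: eqP => [->|]; rewrite ?xB ?andbF.
split=> [||r s rR sS|c s cC sS] //.
- by apply: (hit (L r)) => // c cC; apply: closed.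
- by apply: (hit (L^~ c)) => // r rR; apply: closed.
Qed.

(** The symbol already occurs in row [r] inside the subsquare, and it occurs only once in that row
    of [L]. The next lemma is the transpose. *)
Lemma latin_on_row (n : nat) (L : array n) m R C S r c :
    latin_square L -> latin_on L m R C S ->
  r \in R -> L r c \in S -> c \in C.
Proof.
move=> [_ _ rowL _] [_ _ rowRCS _] rR LS.
have /eqP := rowRCS r (L r c) rR LS; case/cards1P=> c' /setP/(_ c').
rewrite !inE eqxx => /andP[c'C /eqP eqL].
have /eqP/cards1P[c0 /setP eqc0] := rowL r (L r c) (in_setT _) (in_setT _).
have:= eqc0 c; have:= eqc0 c'; rewrite !inE eqL eqxx.
by move=> /esym/eqP <- /esym/eqP ->.
Qed.

Lemma latin_on_col (n : nat) (L : array n) m R C S r c :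
    latin_square L -> latin_on L m R C S ->
  c \in C -> L r c \in S -> r \in R.
Proof.
move=> [_ _ _ colL] [_ _ _ colRCS] cC LS.
have /eqP := colRCS c (L r c) cC LS; case/cards1P=> r' /setP/(_ r').
rewrite !inE eqxx => /andP[r'R /eqP eqL].
have /eqP/cards1P[r0 /setP eqr0] := colL c (L r c) (in_setT _) (in_setT _).
have:= eqr0 r; have:= eqr0 r'; rewrite !inE eqL eqxx.
by move=> /esym/eqP <- /esym/eqP ->.
Qed.

Lemma latin_col_inj (n : nat) (L : array n) c :
  latin_square L -> injective (L^~ c).
Proof.
move=> [_ _ _ colL] r r' /= eqL.
have /eqP/cards1P[r0 /setP eqr0] := colL c (L r c) (in_setT _) (in_setT _).
have:= eqr0 r; have:= eqr0 r'; rewrite !inE -eqL eqxx.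
by move=> /esym/eqP -> /esym/eqP ->.
Qed.

Lemma disjoint_subsquares_bound (n : nat) (L : array n) m m'
    (R C S R' C' S' : {set 'I_n}) :
    latin_square L -> latin_on L m R C S -> latin_on L m' R' C' S' ->
    [disjoint R & R'] -> [disjoint C & C'] -> [disjoint S & S'] ->
    0 < m' -> m + m + m' <= n.
Proof.
move=> latL sq sq' disR disC disS m'_gt0.
have [[cardR _ cardS] _ _ _] := sq; have [[_ cardC' cardS'] _ _ _] := sq'.
have /card_gt0P[c cC'] : 0 < #|C'| by rewrite cardC'.
(* A symbol of [S] would pull the column [c] into [C]; one of [S'] would pull the row into [R']. *)
have dis : [disjoint (L^~ c) @: R & S :|: S'].
  apply/pred0P => s /=; apply/negP => /andP[/imsetP[r rR ->]].
  case/setUP=> [LS|LS'].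
    have cC := latin_on_row latL sq rR LS.
    by rewrite (disjointFr disC cC) in cC'.
  have rR' := latin_on_col latL sq' cC' LS'.
  by rewrite (disjointFr disR rR) in rR'.
have cardU (A B : {set 'I_n}) : [disjoint A & B] -> #|A :|: B| = #|A| + #|B|.
  by rewrite -leq_card_setU => /eqP.
have := cardU _ _ dis; rewrite (cardU _ _ disS).
rewrite card_imset; last exact: latin_col_inj.
by rewrite cardR cardS cardS' -addnA => <-; rewrite -[leqRHS]card_ord max_card.
Qed.

(** * The outline square for two subsquares *)

Section Classes.

Variables a b c : nat.

Definition class (i : 'I_(a + b + c)) : 'I_3 :=
  if i < a then inord 0 else if i < a + b then inord 1 else inord 2.

Lemma card_class k : #|[set i | class i == k]| = nth 0 [:: a; b; c] k.
Proof.
rewrite -sum1dep_card big_mkcond /= !big_split_ord /=.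
rewrite (eq_bigr (fun=> (k == 0 :> nat) : nat)) => [|i _]; last first.
  by rewrite /class /= ltn_ord -val_eqE /= inordK // eq_sym; case: eqP.
rewrite [X in _ + X + _](eq_bigr (fun=> (k == 1 :> nat) : nat)) => [|i _]; last first.
  rewrite /class /= ltnNge leq_addr ltn_add2l ltn_ord -val_eqE /= inordK //.
  by rewrite eq_sym; case: eqP.
rewrite [X in _ + X](eq_bigr (fun=> (k == 2 :> nat) : nat)) => [|i _]; last first.
  rewrite /class /= !ltnNge leq_addr -addnA leq_addr -val_eqE /= inordK //.
  by rewrite eq_sym; case: eqP.
rewrite !sum_nat_const !card_ord.
by case: k => [[|[|[|]]] //= _]; lia.
Qed.

(* Symmetric in its arguments, so that it depends only on how many of them are
   the first and the second class. *)
Definition outline (i j k : 'I_3) : nat :=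
  match count_mem 0 [:: i : nat; j : nat; k : nat],
        count_mem 1 [:: i : nat; j : nat; k : nat] with
  | 3, 0 => a * a
  | 0, 3 => b * b
  | 1, 1 => a * b
  | 1, 0 => a * (c - b)
  | 0, 1 => b * (c - a)
  | 0, 0 => (c - a) * (c - b) + a * b
  | _, _ => 0
  end.

Lemma outlineC i j k : outline i j k = outline j i k.
Proof. by rewrite /outline /= !(addnCA ((i : nat) == _)). Qed.

Lemma outlineCA i j k : outline i j k = outline i k j.
Proof. by rewrite /outline /= !addn0 !(addnC ((j : nat) == _)). Qed.

(** The zeros imposed by the subsquares and these line sums determine all values of [outline]. The
    hypotheses make the truncated subtractions exact; by symmetry one direction of summation covers
    all three. *)
Lemma sum_outline i j : b <= a -> a <= c ->
  \sum_k outline i j k = nth 0 [:: a; b; c] i * nth 0 [:: a; b; c] j.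
Proof.
move=> leba leac; rewrite !big_ord_recl big_ord0 addn0.
by case: i j => [[|[|[|]]] //= i3] [[|[|[|]]] //= j3]; rewrite /outline /=; nia.
Qed.

(** This gives closure of the subsquares: classes 0 and 1 are theirs, class 2 is the rest. *)
Lemma outline_gt0_diag (i k : 'I_3) : i < 2 -> 0 < outline i i k -> k = i.
Proof.
move=> lti; rewrite /outline; case: i lti => [[|[|[|]]] //= i3] _;
by case: k => [[|[|[|]]] //= k3] _; apply: val_inj.
Qed.

End Classes.

Theorem theorem4p1 (h1 h2 h3 n : nat) (h21 : h2 <= h1) (h2_gt0 : 0 < h2)
    (def_n : n = h1 + h2 + h3) :
  (exists L : array n, is_ILS [:: h1; h2] L) <-> h1 <= h3.
Proof.
split=> [[L [latL [R [C [S [sq dis]]]]]]|h13].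
  have [disR disC disS] := dis ord0 ord_max isT.
  have := disjoint_subsquares_bound latL (sq ord0) (sq ord_max) disR disC disS h2_gt0.
  by rewrite /= def_n; lia.
subst n; pose cls := @class h1 h2 h3.
have [|||L [injr injc LT]] := @latin_of_outline _ _ cls (outline h1 h2 h3).
- by move=> i j; rewrite !card_class sum_outline.
- move=> i k; rewrite !card_class -sum_outline //.
  by apply: eq_bigr => j _; rewrite outlineCA.
- move=> j k; rewrite !card_class -sum_outline //.
  by apply: eq_bigr => i _; rewrite outlineC outlineCA.
pose M : array (h1 + h2 + h3) := (\matrix_(i, j) L i j)%R.
have injMr r : injective (M r) by move=> j j'; rewrite !mxE; apply: injr.
have injMc j : injective (M^~ j) by move=> i i' /=; rewrite !mxE; apply: injc.
exists M; split.
  by apply: latin_on_inj; rewrite ?cardsT ?card_ord // => r c _ _; rewrite inE.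
(* Rows, columns and symbols share one partition, so the same block serves as all three sets of a
   subsquare. *)
pose B (k : 'I_2) := [set i | cls i == widen_ord (leqnSn 2) k].
exists B, B, B; split=> [k|k k' neq_kk'].
  apply: latin_on_inj; rewrite ?card_class //; try by case: k => [[|[|]]].
  move=> i j; rewrite !inE mxE => /eqP ci /eqP cj; apply/eqP.
  by have := LT i j; rewrite ci cj; apply: outline_gt0_diag; exact: (ltn_ord k).
have // : [disjoint B k & B k'].
apply/pred0P => i; rewrite /= !inE; apply: contraNF neq_kk'.
by move=> /andP[/eqP-> /eqP/(congr1 val)/= eqk]; apply/eqP/val_inj.
Qed.
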